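(* Let $d\in\{1,2,3\}$, let $\Omega\subset\mathbb{R}^d$ be a bounded domain and let $T>0$. There is an integer $m$ such that the following holds (''sufficiently smooth'' means of class $C^m$ up to the boundary). Let $u:\overline\Omega\times[0,T]\to\mathbb{R}^d$ be sufficiently smooth with $u=0$ on $\partial\Omega\times[0,T]$, and let $\zeta:\overline\Omega\times[0,T]\to\mathbb{R}^{d\times d}$ be sufficiently smooth. Then there is a constant $C>0$, independent of $\Delta t$, $x$ and $t$, such that for every $\Delta t>0$ with $\Delta t\,|u|_{C^0([0,T];W^{1,\infty}(\Omega)^d)}\le 1/8$, every $x\in\overline\Omega$ and every $t\in[2\Delta t,T]$, $$\Bigl|\overset{\nabla}{\zeta}(x,t)-\frac{1}{2\Delta t}\Bigl[3\zeta(x,t)-4L_1(x,t)\,\zeta\bigl(X_1(x,t),t-\Delta t\bigr)\,L_1(x,t)^\top+\tilde L_1(x,t)\,\zeta\bigl(\tilde X_1(x,t),t-2\Delta t\bigr)\,\tilde L_1(x,t)^\top\Bigr]\Bigr|\le C\,\Delta t^2 ,$$ where $X_1(x,t)=x-\Delta t\,u(x,t)$, $\tilde X_1(x,t)=x-2\Delta t\,u(x,t)$, $L_1(x,t)=I+\Delta t\,(\nabla u)(x,t)$ and $\tilde L_1(x,t)=I+2\Delta t\,(\nabla u)(x,t)$.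
   Context: Notation: $(\nabla u)_{ij}=\partial u_i/\partial x_j$; $I$ is the $d\times d$ identity matrix; ${}^\top$ denotes transpose; $|\cdot|$ is the Euclidean norm (Frobenius norm for matrices). The seminorm is $|u|_{C^0([0,T];W^{1,\infty}(\Omega)^d)}=\max_{t\in[0,T]}\operatorname{ess\,sup}_{x\in\Omega}|\nabla u(x,t)|$. The upper-convected time derivative of a matrix-valued function $\zeta$ with respect to the velocity $u$ is $$\overset{\nabla}{\zeta}=\frac{\partial\zeta}{\partial t}+(u\cdot\nabla)\zeta-(\nabla u)\zeta-\zeta(\nabla u)^\top,$$ where $(u\cdot\nabla)\zeta=\sum_k u_k\,\partial\zeta/\partial x_k$ entrywise. A function on $\overline\Omega\times[0,T]$ is of class $C^m$ up to the boundary if all its partial derivatives of order at most $m$ in $\Omega\times(0,T)$ exist and extend continuously to $\overline\Omega\times[0,T]$; derivatives at boundary points mean these extensions. The conditions on $u$ and $\Delta t$ ensure that $X_1(x,t),\tilde X_1(x,t)\in\overline\Omega$ for all $x\in\overline\Omega$. *)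

(* Defs.v *)
From HB Require Import structures.
From mathcomp Require Import all_boot all_order all_algebra.
From mathcomp Require Import all_classical all_reals all_analysis.
From mathcomp Require Import ess_sup_inf.

Set Implicit Arguments.
Unset Strict Implicit.
Unset Printing Implicit Defensive.

Import Order.TTheory GRing.Theory Num.Def Num.Theory.
Import numFieldNormedType.Exports.

Local Open Scope classical_set_scope.
Local Open Scope ring_scope.

Section tuple_cons_measure.
Context {R : realType} {n : nat}.
Local Notation RR := (measurableTypeR R).
Variable mu : {sigma_finite_measure set (n.-tuple RR) -> \bar R}.

Definition tuple_cons (p : RR * n.-tuple RR) : n.+1.-tuple RR :=
  [tuple of p.1 :: p.2].

Definition tuple_uncons (v : n.+1.-tuple RR) : RR * n.-tuple RR :=
  (thead v, [tuple of behead v]).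

Lemma tuple_consK : cancel tuple_cons tuple_uncons.
Proof.
by case=> a v; congr pair; rewrite /tuple_cons ?theadE//; exact/val_inj.
Qed.

Lemma measurable_tuple_cons : measurable_fun setT tuple_cons.
Proof. exact: measurable_cons. Qed.

Lemma measurable_tuple_uncons : measurable_fun setT tuple_uncons.
Proof.
apply/measurable_fun_pairP; split; last exact: measurable_behead.
exact: measurable_tnth.
Qed.

Definition cons_measure : set (n.+1.-tuple RR) -> \bar R :=
  pushforward (lebesgue_measure \x mu)%E tuple_cons.

HB.instance Definition _ := Measure.copy cons_measure
  (@measure_function_pushforward__canonical__measure_function_Measure
     _ _ _ _ _ (lebesgue_measure \x mu)%E tuple_cons measurable_tuple_cons).

Lemma cons_measure_sigma_finite : sigma_finite setT cons_measure.
Proof.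
have /sigma_finiteP[F [TF ndF Foo]] := sigma_finiteT (@lebesgue_measure R).
have /sigma_finiteP[G [TG ndG Goo]] := sigma_finiteT mu.
exists (fun k => tuple_uncons @^-1` (F k `*` G k)) => [|k].
  rewrite -preimage_bigcup -(preimage_setT tuple_uncons); congr preimage.
  rewrite -setXTT TF TG predeqE => -[x y]; split => [[/= [k _ Fx] [l _ Gy]]|].
    exists (maxn k l) => //; split.
    - by move: x Fx; exact/subsetPset/ndF/leq_maxl.
    - by move: y Gy; exact/subsetPset/ndG/leq_maxr.
  by move=> [k _ []/= ? ?]; split; exists k.
have [[mF Fk] [mG Gk]] := (Foo k, Goo k); split.
  rewrite -[X in measurable X]setTI.
  by apply: measurable_tuple_uncons => //; exact: measurableX.
rewrite /cons_measure /pushforward -comp_preimage.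
rewrite (_ : _ \o _ = id) ?preimage_id; last first.
  by apply/funext => p; exact: tuple_consK.
by rewrite product_measure1E// lte_mul_pinfty// ge0_fin_numE.
Qed.

HB.instance Definition _ := Measure_isSigmaFinite.Build _ _ _
  cons_measure cons_measure_sigma_finite.

End tuple_cons_measure.

(* The d-dimensional Lebesgue measure on Borel sets of d-tuples, as the iterated
   product of the one-dimensional one; negligible sets are subsets of Borel
   null sets, so almost-everywhere statements agree with those for the
   completed measure. *)
Fixpoint lebesgue_tuple (R : realType) (n : nat) :
    {sigma_finite_measure set (n.-tuple (measurableTypeR R)) -> \bar R} :=
  if n is m.+1 then cons_measure (lebesgue_tuple R m)
  else (\d_([tuple] : 0.-tuple (measurableTypeR R))).

Definition col_of_tuple (R : realType) (n : nat)
  (v : n.-tuple (measurableTypeR R)) : 'cV[R]_n := \col_i tnth v i.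

Definition frobenius (R : realType) (m n : nat) (A : 'M[R]_(m, n)) : R :=
  Num.sqrt (\sum_i \sum_j A i j ^+ 2).

Section space_time.
Context {R : realType} {d : nat}.
Local Notation point := ('cV[R]_d * R)%type.
Implicit Types (f : point -> R) (p : point).

(* None is the time direction. *)
Definition axis (k : option 'I_d) : point :=
  if k is Some i then (delta_mx i 0, 0) else (0, 1).

Definition partial (k : option 'I_d) f : point -> R := fun p => 'D_(axis k) f p.

(* The head of s is the outermost derivative. *)
Definition iter_partial (s : seq (option 'I_d)) f : point -> R :=
  foldr partial f s.

Variables (Omega : set 'cV[R]_d) (T : R).

Definition cylinder : set point := Omega `*` `]0, T[.

Definition ccylinder : set point := closure Omega `*` `[0, T].

(* For the empty sequence of directions the extension is required to be f
   itself on the closed cylinder: this is the first conjunct. *)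
Definition smooth_upto_boundary (m : nat) f : Prop :=
  [/\ {within ccylinder, continuous f},
      forall s k p, (size s < m)%N -> cylinder p ->
        derivable (iter_partial s f) p (axis k) &
      forall s, (size s <= m)%N ->
        exists2 g : point -> R, {within ccylinder, continuous g} &
          forall p, cylinder p -> g p = iter_partial s f p].

(* The continuous extension to the closed cylinder of the partial derivative
   taken in the open cylinder; it is the partial derivative itself at points
   of the open cylinder where the latter is continuous. *)
Definition bpartial (k : option 'I_d) f : point -> R :=
  fun p => lim (partial k f q @[q --> within cylinder (nbhs p)]).

Definition gradient (u : point -> 'cV[R]_d) p : 'M[R]_d :=
  \matrix_(i, j) bpartial (Some j) (fun q => u q i 0) p.

Definition time_derivative (z : point -> 'M[R]_d) p : 'M[R]_d :=
  \matrix_(i, j) bpartial None (fun q => z q i j) p.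

Definition advection (u : point -> 'cV[R]_d) (z : point -> 'M[R]_d) p :
    'M[R]_d :=
  \matrix_(i, j) \sum_k u p k 0 * bpartial (Some k) (fun q => z q i j) p.

Definition upper_convected (u : point -> 'cV[R]_d) (z : point -> 'M[R]_d) p :
    'M[R]_d :=
  time_derivative z p + advection u z p
  - gradient u p *m z p - z p *m (gradient u p)^T.

(* The value -oo outside Omega makes this the essential supremum over Omega.
   The maximum over t is written as a supremum in the extended reals. *)
Definition seminorm_C0W1oo (u : point -> 'cV[R]_d) : \bar R :=
  ereal_sup [set ess_sup (lebesgue_tuple R d)
      (patch (fun=> -oo%E) (@col_of_tuple R d @^-1` Omega)
        (fun y => (frobenius (gradient u (col_of_tuple y, t)))%:E))
    | t in `[0, T]].

End space_time.

Section two_step_scheme.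
Context {R : realType} {d : nat}.
Local Notation point := ('cV[R]_d * R)%type.
Variables (Omega : set 'cV[R]_d) (T : R) (u : point -> 'cV[R]_d).

(* foot (k * dt) is X_1 for k = 1 and \tilde X_1 for k = 2; likewise
   deformation (k * dt) is L_1 and \tilde L_1. *)
Definition foot (h : R) (x : 'cV[R]_d) (t : R) : 'cV[R]_d := x - h *: u (x, t).

Definition deformation (h : R) (x : 'cV[R]_d) (t : R) : 'M[R]_d :=
  1%:M + h *: gradient Omega T u (x, t).

Definition bdf2_upper_convected (z : point -> 'M[R]_d) (dt : R)
    (x : 'cV[R]_d) (t : R) : 'M[R]_d :=
  let L1 := deformation dt x t in
  let L2 := deformation (2 * dt) x t in
  (2 * dt)^-1 *:
    (3 *: z (x, t)
     - 4 *: (L1 *m z (foot dt x t, t - dt) *m L1^T)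
     + L2 *m z (foot (2 * dt) x t, t - 2 * dt) *m L2^T).

End two_step_scheme.

(* Main.v *)
(* Freezing (x, t) and writing v = u(x, t), G = (grad u)(x, t), the bracket of the
   scheme samples the curve
     Z(s) = (I + s G) zeta(x - s v, t - s) (I + s G)^T
   at s = 0, dt, 2 dt. The three-point backward stencil is second-order accurate
   for - Z'(0), which is exactly the upper-convected derivative, so a Taylor
   expansion of Z with a uniformly bounded cubic remainder suffices. For x in
   Omega the whole segment x - s v, s <= 2 dt, stays in Omega: at a first exit
   point u vanishes, and dt |grad u| <= 1/8 then forces v = 0. This settles the
   points of the open cylinder; since the derivatives of u and zeta extend
   continuously, the estimate passes to the limit on the closed cylinder. *)
Require Import Defs.
From mathcomp Require Import all_boot all_order all_algebra.
From mathcomp Require Import all_classical all_reals all_analysis.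
From mathcomp Require Import ess_sup_inf.
From mathcomp Require Import ring lra.
Set Implicit Arguments.
Unset Strict Implicit.
Unset Printing Implicit Defensive.

Import Order.TTheory GRing.Theory Num.Def Num.Theory.
Import numFieldNormedType.Exports.
Local Open Scope classical_set_scope.
Local Open Scope ring_scope.

(** * Directional derivatives and the mean value theorem on a segment *)

Section line_derivative.
Context {R : realType} {V : normedModType R}.
Implicit Types (f : V -> R) (p q w e : V).

Lemma is_derive_line f p w (c s : R) : derivable f (p + (s * c) *: w) w ->
  is_derive s 1 (fun s => f (p + (s * c) *: w))
    (c * 'D_w f (p + (s * c) *: w)).
Proof.
move=> df; pose g (r : R) := f (p + r *: w).
have quotE : (fun h : R => h^-1 *: ((g \o shift (s * c)) (h *: 1) - g (s * c))) =
    (fun h : R => h^-1 *: ((f \o shift (p + (s * c) *: w)) (h *: w) -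
                           f (p + (s * c) *: w))).
  apply/funext => h; rewrite /g /=; congr (_ *: (f _ - _)).
  by rewrite (_ : h *: 1 = h) ?scalerDl 1?addrCA//; exact: mulr1.
have gP : is_derive (s * c) 1 g ('D_w f (p + (s * c) *: w)).
  split; first by rewrite /derivable quotE.
  by rewrite /derive quotE.
have idP : is_derive s 1 (fun r : R => r * c) c.
  rewrite (_ : (fun r => _) = c *: (@id R)).
    by apply: is_derive_eq; rewrite /GRing.scale /= mulr1.
  by apply/funext => r /=; rewrite /GRing.scale /= mulrC.
rewrite mulrC; exact: (@is_derive1_comp _ g (fun r : R => r * c) s _ _ gP idP).
Qed.

(** The segment is parametrized by [s] in [0, 1] with [c] as a factor, so that [c] may have either
    sign: it will be an increment tending to 0 from both sides. *)
Lemma mvt_line f p w (c : R) :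
  (forall s : R, 0 <= s <= 1 -> derivable f (p + (s * c) *: w) w) ->
  exists2 s : R, 0 <= s <= 1 &
    f (p + c *: w) - f p = c * 'D_w f (p + (s * c) *: w).
Proof.
move=> df.
have dg (s : R) : s \in `[0, 1] -> is_derive s 1 (fun s => f (p + (s * c) *: w))
    (c * 'D_w f (p + (s * c) *: w)).
  by rewrite in_itv /= => s01; exact/is_derive_line/df.
have cg : {within `[0, 1], continuous (fun s => f (p + (s * c) *: w))}.
  by apply: derivable_within_continuous => s /dg [].
have dg' (s : R) : s \in `]0, 1[ -> is_derive s 1 (fun s => f (p + (s * c) *: w))
    (c * 'D_w f (p + (s * c) *: w)) by move=> /subset_itv_oo_cc /dg.
have [s] := MVT_segment ler01 dg' cg.
rewrite in_itv /= mul1r mul0r scale0r addr0 subr0 mulr1 => s01 ->.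
by exists s.
Qed.

(* Moving first along [w] and then along [e], the second increment is a
   directional derivative in direction [e] at a nearby point, by the mean value
   theorem. *)
Lemma is_derive_add_axis f p e w (c dw : R) :
  (\forall q \near p, derivable f q e) -> {for p, continuous ('D_e f)} ->
  is_derive p w f dw -> is_derive p (c *: e + w) f (c * 'D_e f p + dw).
Proof.
move=> dfe cfe [dfw Dfw].
have quot_cvg : h^-1 *: (f (p + h *: w + (h * c) *: e) - f (p + h *: w))
    @[h --> (0 : R)^'] --> c * 'D_e f p.
  apply/cvgrPdist_lt => eps eps0.
  have c1 : 0 < `|c| + 1 by rewrite ltr_wpDl.
  have /nbhs_ballP[d /= d0 dP] : \forall q \near p, derivable f q e /\
      `|'D_e f p - 'D_e f q| < eps / (`|c| + 1).
    near=> q; split; near: q => //.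
    by move/cvgrPdist_lt: cfe; apply; rewrite divr_gt0.
  (* Every point of the second leg lies within [|h| * m] of [p]; the summand 1 makes [m]
     positive. *)
  pose m := `|w| + `|c| * `|e| + 1.
  have m0 : 0 < m by rewrite ltr_wpDl// addr_ge0// mulr_ge0.
  near=> h.
  have hd : `|h| * m < d.
    rewrite -ltr_pdivlMr//; near: h; apply: dnbhs0_lt; exact: divr_gt0.
  have h0 : h != 0 by near: h; exact: nbhs_dnbhs_neq.
  have inb (s : R) : 0 <= s <= 1 -> ball p d (p + h *: w + (s * (h * c)) *: e).
    move=> /andP[s0 s1]; rewrite -ball_normE /ball_ /= -addrA opprD addNKr normrN.
    apply: le_lt_trans hd; rewrite (le_trans (ler_normD _ _))//.
    rewrite !normrZ /m mulrDr mulr1 ler_wpDr// mulrDr lerD//.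
    rewrite [leRHS]mulrA ler_wpM2r// ler_piMl// ?mulr_ge0//.
    by rewrite ger0_norm.
  have [|s s01 ->] := @mvt_line f (p + h *: w) e (h * c).
    by move=> s /inb /dP [].
  have [_ lt_eps] := dP _ (inb _ s01).
  rewrite -mulrA /GRing.scale /= mulKf// -mulrBr normrM.
  rewrite (le_lt_trans (ler_wpM2l (normr_ge0 c) (ltW lt_eps)))//.
  by rewrite mulrCA gtr_pMr// ltr_pdivrMr// mul1r ltrDl.
have sum_cvg : h^-1 *: ((f \o shift p) (h *: (c *: e + w)) - f p)
    @[h --> (0 : R)^'] --> c * 'D_e f p + dw.
  rewrite (_ : (fun h => _) = (fun h : R =>
      h^-1 *: (f (p + h *: w + (h * c) *: e) - f (p + h *: w)) +
      h^-1 *: ((f \o shift p) (h *: w) - f p))).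
    by apply: cvgD => //; rewrite -Dfw; exact: dfw.
  apply/funext => h /=; rewrite -scalerDr; congr (_ *: _).
  rewrite [h *: w + p]addrC addrA subrK scalerDr scalerA.
  by rewrite [_ + h *: w]addrC [_ + p]addrC !addrA.
split; first by apply/cvg_ex; exists (c * 'D_e f p + dw).
exact: cvg_lim.
Unshelve. all: by end_near. Qed.

End line_derivative.

(** * Partial derivatives, smoothness up to the boundary, bounds on the cylinder *)

Section smooth_functions.
Context {R : realType} {d : nat}.
Local Notation point := ('cV[R]_d * R)%type.
Implicit Types (f : point -> R) (p w : point) (k : option 'I_d).

Definition component k w : R := if k is Some i then w.1 i 0 else w.2.

Lemma sum_axes (U : nmodType) (F : option 'I_d -> U) :
  \sum_k F k = F None + \sum_i F (Some i).
Proof.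
rewrite (bigD1 None)//=; congr (_ + _).
by rewrite (reindex_omap Some id)/= => [|[]//]; apply: eq_bigl => i; rewrite eqxx.
Qed.

Lemma axis_decomposition w : w = \sum_k component k w *: axis k.
Proof.
rewrite sum_axes /= [RHS]surjective_pairing /=.
have fstE (F : 'I_d -> point) : (\sum_i F i).1 = \sum_i (F i).1.
  exact: (raddf_sum fst).
have sndE (F : 'I_d -> point) : (\sum_i F i).2 = \sum_i (F i).2.
  exact: (raddf_sum snd).
rewrite fstE sndE; case: w => x t /=; congr pair.
  rewrite scaler0 add0r {1}[x]matrix_sum_delta.
  by apply: eq_bigr => i _; rewrite big_ord1.
rewrite big1 => [|i _]; first by rewrite addr0; exact/esym/mulr1.
by rewrite scaler0.
Qed.

Definition C1_on (U : set point) f := forall p k, U p ->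
  derivable f p (axis k) /\ {for p, continuous (partial k f)}.

(** The direction is assembled axis by axis from the zero vector; [is_derive_add_axis] produces one
    term of the sum at each stage. *)
Lemma is_derive_C1 (U : set point) f p w : open U -> C1_on U f -> U p ->
  is_derive p w f (\sum_k component k w * partial k f p).
Proof.
move=> oU C1f Up; rewrite {1}[w]axis_decomposition.
elim/big_rec2: _ => [|k dw v _ IH]; first exact: is_derive0.
apply: is_derive_add_axis => //; last by have [] := C1f p k Up.
by near=> q; have [] // := C1f q k; near: q; exact: open_nbhs_nbhs.
Unshelve. all: by end_near. Qed.

Lemma trmx_continuous m n : continuous (@trmx R m n).
Proof.
move=> M s /= /nbhs_ballP[e e0 es]; apply/nbhs_ballP; exists e => // N [_ MN].
by apply: es; split=> // i j; rewrite !mxE.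
Qed.

Lemma mx_entry_le_norm m n (A : 'M[R]_(m, n)) i j : `|A i j| <= `|A|.
Proof.
rewrite [leRHS]/normr /= mx_normrE.
by apply/bigmax_geP; right; exists (i, j).
Qed.

Lemma norm_trmx m n (A : 'M[R]_(m, n)) : `|A^T| = `|A|.
Proof.
suff le_tr m' n' (B : 'M[R]_(m', n')) : `|B^T| <= `|B|.
  by apply/eqP; rewrite eq_le le_tr -{1}[A]trmxK le_tr.
rewrite [leLHS]/normr /= mx_normrE; apply/bigmax_leP; split=> // -[i j] _ /=.
by rewrite mxE mx_entry_le_norm.
Qed.

(** Heine-Borel is applied to row vectors; transposition is continuous and preserves the max norm,
    so it carries closedness, boundedness and compactness across. *)
Lemma compact_closure (A : set 'cV[R]_d) : bounded_set A -> compact (closure A).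
Proof.
move=> bA.
have -> : closure A = trmx @` (trmx @^-1` closure A).
  apply/seteqP; split=> [x Ax|_ [y Ay <-]//].
  by exists x^T; rewrite /= trmxK.
apply: continuous_compact; first exact/continuous_subspaceT/trmx_continuous.
apply: bounded_closed_compact; last first.
  by apply: preimage_closed => [x _|]; [exact: trmx_continuous|exact: closed_closure].
move: bA => [M [Mreal AM]]; exists M; split=> // N /AM AN.
have clA : closure A `<=` [set x | `|x| <= N].
  rewrite closureE; apply: smallest_sub => //.
  have -> : [set x : 'cV[R]_d | `|x| <= N] = normr @^-1` [set y | y <= N] by [].
  by apply: preimage_closed => [x _|]; [exact: norm_continuous|exact: closed_le].
by move=> y /clA /=; rewrite norm_trmx.
Qed.

Variables (Omega : set 'cV[R]_d) (T : R).
Hypotheses (Omega_open : open Omega) (T_gt0 : 0 < T).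
Local Notation cyl := (cylinder Omega T).
Local Notation ccyl := (ccylinder Omega T).

Lemma open_cylinder : open cyl.
Proof.
have -> : cyl = fst @^-1` Omega `&` snd @^-1` `]0, T[%classic.
  by apply/seteqP; split=> -[x t] [].
apply: openI; apply: open_comp => // p _; [exact: cvg_fst|exact: cvg_snd].
Qed.

Lemma cylinderW : cyl `<=` ccyl.
Proof. by move=> [x t] [/= /subset_closure xO /subset_itv_oo_cc tT]. Qed.

Lemma ccylinder_closure : ccyl `<=` closure cyl.
Proof.
move=> [x t] [/= clx tT] W /nbhs_ballP[e /= e0 eW].
have [y [Oy xy]] := clx _ (nbhsx_ballx x _ e0).
move: tT; rewrite in_itv /= => /andP[t0 tT].
(* The time is moved by the fraction [l] of the way towards [T / 2], hence strictly inside the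
   interval, and [l * T < e] keeps the shift below [e]. *)
pose l := Num.min 1 (e / (2 * T)).
have l0 : 0 < l by rewrite lt_min ltr01 divr_gt0// mulr_gt0.
have l1 : l <= 1 by rewrite ge_min lexx.
have lT : l * T < e.
  rewrite -ltr_pdivlMr// gt_min; apply/orP; right.
  by rewrite invfM mulrA [e / 2 / T]mulrAC gtr_pMr ?divr_gt0// invf_lt1 ?ltr1n.
exists (y, t + l * (T / 2 - t)); split.
  have lT0 : 0 < l * T by exact: mulr_gt0.
  have lt0 : 0 <= (1 - l) * t by rewrite mulr_ge0// subr_ge0.
  have lTt : 0 <= (1 - l) * (T - t) by rewrite mulr_ge0// subr_ge0.
  by split=> //=; rewrite in_itv /=; apply/andP; split; lra.
apply: eW; split => //=; rewrite -ball_normE /ball_ /= opprD addNKr normrN.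
by rewrite (le_lt_trans _ lT)// normrM gtr0_norm// ler_pM2l// ler_norml; lra.
Qed.

Lemma within_cylinder_proper p : ccyl p -> ProperFilter (within cyl (nbhs p)).
Proof. by move=> /ccylinder_closure; exact: within_nbhs_proper. Qed.

Lemma compact_ccylinder : bounded_set Omega -> compact ccyl.
Proof.
move=> bO; apply: compact_setX; first exact: compact_closure.
exact: segment_compact.
Qed.

Lemma within_ccylinder_bounded f : bounded_set Omega ->
  {within ccyl, continuous f} -> exists M, forall p, ccyl p -> `|f p| <= M.
Proof.
move=> bO cf.
have /compact_bounded[M [_ fM]] := continuous_compact cf (compact_ccylinder bO).
exists (M + 1) => p clp; apply: (fM (M + 1)); first by rewrite ltrDl.
by exists p.
Qed.

Lemma within_ccylinder_continuous f p :
  {within ccyl, continuous f} -> cyl p -> {for p, continuous f}.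
Proof.
move=> cf cp; have := continuous_subspaceW cylinderW cf.
by rewrite continuous_open_subspace; [apply; rewrite inE|exact: open_cylinder].
Qed.

Lemma near_eq_continuous f g p : (\forall q \near p, f q = g q) ->
  {for p, continuous f} -> {for p, continuous g}.
Proof.
move=> fg; rewrite /prop_for /continuous_at (nbhs_singleton fg) => fp.
apply: cvg_trans fp; exact: near_eq_cvg.
Qed.

(** One order is spent on continuity: the partial derivatives of [iter_partial s f] have order
    [size s + 1], and near a point of the open cylinder they agree with their continuous
    extension. *)
Lemma smooth_C1 m f s : smooth_upto_boundary Omega T m f -> (size s < m)%N ->
  C1_on cyl (iter_partial s f).
Proof.
move=> [_ df ext] sm p k cp; split; first exact: df.
have [g cg gE] := ext (k :: s) sm.
apply: (@near_eq_continuous g); last exact: within_ccylinder_continuous.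
near=> q; apply: gE; near: q; apply: open_nbhs_nbhs.
by split => //; exact: open_cylinder.
Unshelve. all: by end_near. Qed.

Lemma smooth_bounded m f s : bounded_set Omega ->
  smooth_upto_boundary Omega T m f -> (size s <= m)%N ->
  exists M, forall p, cyl p -> `|iter_partial s f p| <= M.
Proof.
move=> bO [_ _ ext] /ext[g cg gE].
have [M gM] := within_ccylinder_bounded bO cg.
by exists M => p cp; rewrite -gE// gM//; exact: cylinderW.
Qed.

(** Every point of the closed cylinder is adherent to the open one, so the limit in [bpartial] is
    unique and equals the extension [g] supplied by smoothness. *)
Lemma bpartial_ext m f k : smooth_upto_boundary Omega T m.+1 f ->
  {within ccyl, continuous (bpartial Omega T k f)} /\
  forall p, cyl p -> bpartial Omega T k f p = partial k f p.
Proof.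
move=> [_ _ ext]; have [//|g cg gE] := ext [:: k].
have bE : {in ccyl, g =1 bpartial Omega T k f}.
  move=> p; rewrite inE => cp; apply/esym; have := within_cylinder_proper cp.
  move=> PF; apply: cvg_lim => //.
  have /subspace_continuousP/(_ p cp) gp := cg.
  apply: cvg_trans (cvg_trans _ gp); last first.
    apply: cvg_fmap2; apply: within_subset; last exact: cylinderW.
  by apply: fmap_within_eq => q; rewrite inE => /gE.
split; first exact: subspace_eq_continuous bE cg.
by move=> p cp; rewrite -bE ?gE// inE; exact: cylinderW.
Qed.

End smooth_functions.

(** * Taylor remainders in one variable and the three-point stencil *)

Section taylor.
Context {R : realType}.
Implicit Types (f df : R -> R) (K h a b c M s : R).

Lemma mvt_power_bound f df h M n : 0 <= M ->
  (forall s, 0 <= s <= h -> is_derive s 1 f (df s)) ->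
  (forall s, 0 <= s <= h -> `|df s| <= M * s ^+ n) ->
  forall s, 0 <= s <= h -> `|f s - f 0| <= M * s ^+ n.+1.
Proof.
move=> M0 Df dfM s /andP[s0 sh].
have inh r : r \in `[0, s] -> 0 <= r <= h.
  by rewrite in_itv /= => /andP[-> /le_trans->].
have cf : {within `[0, s], continuous f}.
  by apply: derivable_within_continuous => r /inh /Df [].
have Df' r : r \in `]0, s[ -> is_derive r 1 f (df r).
  by move=> /subset_itv_oo_cc /inh /Df.
have [r rs ->] := MVT_segment s0 Df' cf.
move: (rs); rewrite in_itv /= => /andP[r0 ler].
rewrite subr0 normrM (ger0_norm s0) exprSr mulrA ler_wpM2r//.
by rewrite (le_trans (dfM _ (inh _ rs)))// ler_wpM2l// lerXn2r.
Qed.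

(** The bound on the third derivative is integrated three times by [mvt_power_bound], each time
    after removing the Taylor polynomial of matching degree. The constant stays [M], without the
    factorials of exact integration. *)
Lemma taylor2_bound f f1 f2 f3 h M : 0 <= M ->
  (forall s, 0 <= s <= h -> is_derive s 1 f (f1 s)) ->
  (forall s, 0 <= s <= h -> is_derive s 1 f1 (f2 s)) ->
  (forall s, 0 <= s <= h -> is_derive s 1 f2 (f3 s)) ->
  (forall s, 0 <= s <= h -> `|f3 s| <= M) ->
  forall s, 0 <= s <= h ->
    `|f s - (f 0 + f1 0 * s + f2 0 / 2 * s ^+ 2)| <= M * s ^+ 3.
Proof.
move=> M0 D0 D1 D2 f3M.
have B2 : forall s, 0 <= s <= h -> `|f2 s - f2 0| <= M * s ^+ 1.
  by apply: mvt_power_bound D2 _ => // s /f3M; rewrite expr0 mulr1.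
have D1' s : 0 <= s <= h -> is_derive s 1 (f1 - f2 0 *: id) (f2 s - f2 0).
  by move=> /D1 D; apply: is_derive_eq; rewrite /GRing.scale /= mulr1.
have B1 := mvt_power_bound M0 D1' B2.
have D0' s : 0 <= s <= h ->
    is_derive s 1 (f - f1 0 *: id - (f2 0 / 2) *: (id ^+ 2))
      (f1 s - f2 0 * s - f1 0).
  move=> /D0 D; apply: is_derive_eq.
  by rewrite /GRing.scale /=; field.
have B0 s : 0 <= s <= h -> `|f1 s - f2 0 * s - f1 0| <= M * s ^+ 2.
  move=> /B1; rewrite !fctE /GRing.scale /=; congr (`|_| <= _); ring.
move=> s /(mvt_power_bound M0 D0' B0).
rewrite !fctE /GRing.scale /=; congr (`|_| <= _); ring.
Qed.

(* A quantitative 2-jet at 0; the quadratic coefficient is hidden because the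
   BDF2 stencil cancels it, so only its bound enters the estimates. *)
Definition expansion K h f a b := exists c,
  [/\ `|a| <= K, `|b| <= K, `|c| <= K &
      forall s, 0 <= s <= h -> `|f s - (a + b * s + c * s ^+ 2)| <= K * s ^+ 3].

Lemma expansion_ge0 K h f a b : expansion K h f a b -> 0 <= K.
Proof. by case=> c [aK _ _ _]; exact: le_trans aK. Qed.

Lemma expansion_affine K h a b : `|a| <= K -> `|b| <= K ->
  expansion K h (fun s => a + s * b) a b.
Proof.
move=> aK bK; have K0 : 0 <= K by exact: le_trans aK.
exists 0; split=> //; first by rewrite normr0.
move=> s /andP[s0 _]; rewrite mul0r addr0 [b * s]mulrC subrr normr0.
by rewrite mulr_ge0// exprn_ge0.
Qed.

Lemma expansion_sum K h n (f : 'I_n -> R -> R) (a b : 'I_n -> R) :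
  (forall i, expansion K h (f i) (a i) (b i)) ->
  expansion (n%:R * K) h (fun s => \sum_i f i s) (\sum_i a i) (\sum_i b i).
Proof.
move=> /choice[c fE].
have sumK (g : 'I_n -> R) L : (forall i, `|g i| <= L) -> `|\sum_i g i| <= n%:R * L.
  move=> gL; rewrite (le_trans (ler_norm_sum _ _ _))//.
  rewrite (le_trans (ler_sum _ (fun i _ => gL i)))//.
  by rewrite sumr_const card_ord mulr_natl.
exists (\sum_i c i); split; try by apply: sumK => i; have [] := fE i.
move=> s sh; rewrite !mulr_suml -!big_split -sumrB /= -mulrA.
by apply: sumK => i; have [_ _ _] := fE i; exact.
Qed.

(** The 2-jets multiply by the Leibniz rule; every term of order at least three goes to the
    remainder, its excess powers of [s] being bounded by powers of [H]. Having [H] in the constant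
    instead of [h] keeps it uniform in the step. *)
Lemma expansion_mul K K' h H f f' a a' b b' : 0 <= H -> h <= H ->
  expansion K h f a b -> expansion K' h f' a' b' ->
  expansion (K * K' * (4 + 3 * H + 2 * H ^+ 2 + H ^+ 3)) h
    (fun s => f s * f' s) (a * a') (a * b' + b * a').
Proof.
move=> H0 hH fE gE; have K0 := expansion_ge0 fE; have K'0 := expansion_ge0 gE.
case: fE => c [aK bK cK fE]; case: gE => c' [aK' bK' cK' gE].
have KK0 : 0 <= K * K' by exact: mulr_ge0.
have prodK x y : `|x| <= K -> `|y| <= K' -> `|x * y| <= K * K'.
  by move=> xK yK; rewrite normrM ler_pM.
have H2 : 0 <= H ^+ 2 by exact: exprn_ge0.
have H3 : 0 <= H ^+ 3 by exact: exprn_ge0.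
have KH i : 0 <= K * K' * H ^+ i by rewrite mulr_ge0// exprn_ge0.
have := KH 1%N; have := KH 2; have := KH 3; rewrite expr1 => KH3 KH2 KH1.
exists (a * c' + b * b' + c * a'); split.
- by have := prodK _ _ aK aK'; lra.
- have := prodK _ _ aK bK'; have := prodK _ _ bK aK'.
  by have := ler_normD (a * b') (b * a'); lra.
- have := prodK _ _ aK cK'; have := prodK _ _ bK bK'; have := prodK _ _ cK aK'.
  have := ler_normD (a * c' + b * b') (c * a').
  by have := ler_normD (a * c') (b * b'); lra.
move=> s /[dup] sh /andP[s0 /le_trans/(_ hH) sH].
have s2 : 0 <= s ^+ 2 by exact: exprn_ge0.
have s3 : 0 <= s ^+ 3 by exact: exprn_ge0.
have sH2 : s ^+ 2 <= H ^+ 2 by rewrite lerXn2r.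
have sH3 : s ^+ 3 <= H ^+ 3 by rewrite lerXn2r.
set r := f s - (a + b * s + c * s ^+ 2).
set r' := f' s - (a' + b' * s + c' * s ^+ 2).
have rK : `|r| <= K * s ^+ 3 by exact: fE.
have rK' : `|r'| <= K' * s ^+ 3 by exact: gE.
pose P := a + b * s + c * s ^+ 2; pose P' := a' + b' * s + c' * s ^+ 2.
have polK x y z L : 0 <= L -> `|x| <= L -> `|y| <= L -> `|z| <= L ->
    `|x + y * s + z * s ^+ 2| <= L * (1 + H + H ^+ 2).
  move=> L0 xL yL zL; rewrite (le_trans (ler_normD _ _))// !mulrDr mulr1 lerD//.
    by rewrite (le_trans (ler_normD _ _))// lerD// normrM ler_pM// ger0_norm.
  by rewrite normrM ler_pM// ger0_norm.
have PK : `|P| <= K * (1 + H + H ^+ 2) by exact: polK.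
have PK' : `|P'| <= K' * (1 + H + H ^+ 2) by exact: polK.
(* The four terms contribute [2 + H], twice [1 + H + H ^+ 2], and [H ^+ 3], which add up to the
   factor in the announced constant. *)
have -> : f s * f' s - (a * a' + (a * b' + b * a') * s +
      (a * c' + b * b' + c * a') * s ^+ 2) =
    (b * c' + c * b' + c * c' * s) * s ^+ 3 + P * r' + r * P' + r * r'.
  by rewrite /P /P' /r /r'; ring.
have T1 : `|(b * c' + c * b' + c * c' * s) * s ^+ 3| <=
    K * K' * (2 + H) * s ^+ 3.
  rewrite normrM (ger0_norm s3) ler_wpM2r//.
  have := prodK _ _ bK cK'; have := prodK _ _ cK bK'.
  have : `|c * c' * s| <= K * K' * H.
    by rewrite normrM ler_pM// ?prodK// ger0_norm.
  have := ler_normD (b * c' + c * b') (c * c' * s).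
  by have := ler_normD (b * c') (c * b'); lra.
have T2 : `|P * r'| <= K * K' * (1 + H + H ^+ 2) * s ^+ 3.
  rewrite normrM (le_trans (ler_pM _ _ PK rK'))//.
  by lra.
have T3 : `|r * P'| <= K * K' * (1 + H + H ^+ 2) * s ^+ 3.
  rewrite normrM (le_trans (ler_pM _ _ rK PK'))//.
  by lra.
have T4 : `|r * r'| <= K * K' * H ^+ 3 * s ^+ 3.
  rewrite normrM (le_trans (ler_pM _ _ rK rK'))//.
  rewrite [leLHS](_ : _ = K * K' * s ^+ 3 * s ^+ 3); last by ring.
  by rewrite ler_wpM2r// ler_wpM2l.
have := ler_normD
  ((b * c' + c * b' + c * c' * s) * s ^+ 3 + P * r' + r * P') (r * r').
have := ler_normD ((b * c' + c * b' + c * c' * s) * s ^+ 3 + P * r') (r * P').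
have := ler_normD ((b * c' + c * b' + c * c' * s) * s ^+ 3) (P * r').
lra.
Qed.

(** The weights 3, -4, 1 annihilate constants and squares and send [b * s] to [- b], so only the
    remainders at [h] and [2 * h] survive: (4 + 8) K h^3 divided by 2h. *)
Lemma bdf2_consistency K h f a b : 0 < h -> f 0 = a -> expansion K (2 * h) f a b ->
  `|- b - (2 * h)^-1 * (3 * f 0 - 4 * f h + f (2 * h))| <= 6 * K * h ^+ 2.
Proof.
move=> h0 f0 [c [_ _ _ fE]].
have rh : `|f h - (a + b * h + c * h ^+ 2)| <= K * h ^+ 3 by apply: fE; lra.
have r2h : `|f (2 * h) - (a + b * (2 * h) + c * (2 * h) ^+ 2)| <= K * (2 * h) ^+ 3.
  by apply: fE; lra.
set r1 := f h - _ in rh; set r2 := f (2 * h) - _ in r2h.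
have -> : - b - (2 * h)^-1 * (3 * f 0 - 4 * f h + f (2 * h)) =
    (2 * h)^-1 * (4 * r1 - r2).
  by rewrite /r1 /r2 f0; field; rewrite gt_eqF.
have h20 : 0 < 2 * h by lra.
rewrite normrM gtr0_norm ?invr_gt0// ler_pdivrMl//.
have := ler_normB (4 * r1) r2; rewrite normrM ger0_norm// => le_r.
rewrite [leRHS](_ : _ = 12 * (K * h ^+ 3)); last by ring.
have r2h' : `|r2| <= 8 * (K * h ^+ 3) by rewrite (le_trans r2h)//; lra.
lra.
Qed.

End taylor.

(** * Cubic expansion of a smooth function along a line in space-time *)

Section line_expansion.
Context {R : realType} {d : nat}.
Local Notation point := ('cV[R]_d * R)%type.
Implicit Types (f : point -> R) (p w : point) (U : set point).

Lemma is_derive_lincomb (I : finType) (c : I -> R) (g : I -> R -> R)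
    (dg : I -> R) (s : R) : (forall k, is_derive s 1 (g k) (dg k)) ->
  is_derive s 1 (fun s => \sum_k c k * g k s) (\sum_k c k * dg k).
Proof.
move=> Dg.
have -> : (fun s => \sum_k c k * g k s) = \sum_k c k *: g k.
  by apply/funext => r; rewrite fct_sumE.
by elim/big_rec2: _ => [|k dw v _ IH]; [exact: is_derive_cst|exact: is_deriveD].
Qed.

Lemma is_derive_line_C1 U f p w (s : R) : open U -> C1_on U f -> U (p + s *: w) ->
  is_derive s 1 (fun s => f (p + s *: w))
    (\sum_k component k w * partial k f (p + s *: w)).
Proof.
move=> oU C1f Us; have [df Df] := is_derive_C1 w oU C1f Us.
have := @is_derive_line _ _ f p w 1 s; rewrite mulr1 mul1r Df => /(_ df).
by under eq_fun do rewrite mulr1.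
Qed.

Lemma le_norm_lincomb (W M : R) (c g : option 'I_d -> R) :
  (forall k, `|c k| <= W) -> (forall k, `|g k| <= M) ->
  `|\sum_k c k * g k| <= d.+1%:R * W * M.
Proof.
move=> cW gM; rewrite (le_trans (ler_norm_sum _ _ _))//.
rewrite (@le_trans _ _ (\sum_(k : option 'I_d) W * M))//.
  by apply: ler_sum => k _; rewrite normrM ler_pM.
by rewrite sumr_const card_option card_ord -[leLHS]mulr_natl mulrA.
Qed.

(** Each differentiation in [s] is a chain rule over the [d.+1] axes and costs a factor A = (d + 1)
    W. The quantity M (1 + A)^3 dominates A^n M for all n up to 3, so one constant bounds the jet
    and the remainder. *)
Lemma expansion_line U f p w (W M h : R) : open U ->
  C1_on U f -> (forall k, C1_on U (partial k f)) ->
  (forall k l, C1_on U (partial l (partial k f))) ->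
  (forall k, `|component k w| <= W) ->
  (forall q, U q -> `|f q| <= M) ->
  (forall k q, U q -> `|partial k f q| <= M) ->
  (forall k l q, U q -> `|partial l (partial k f) q| <= M) ->
  (forall k l j q, U q -> `|partial j (partial l (partial k f)) q| <= M) ->
  0 <= h -> (forall s, 0 <= s <= h -> U (p + s *: w)) ->
  expansion (M * (1 + d.+1%:R * W) ^+ 3) h (fun s => f (p + s *: w)) (f p)
    (\sum_k component k w * partial k f p).
Proof.
move=> oU C0 C1 C2 wW M0 M1 M2 M3 h0 lineU.
have Up : U p by have := lineU 0; rewrite scale0r addr0; apply; rewrite lexx.
have Mge0 : 0 <= M by exact: le_trans (M0 _ Up).
have Wge0 : 0 <= W by exact: le_trans (wW None).
set A := d.+1%:R * W; have A0 : 0 <= A by exact: mulr_ge0.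
have leK n : (n <= 3)%N -> A ^+ n * M <= M * (1 + A) ^+ 3.
  move=> n3; rewrite mulrC ler_wpM2l// (@le_trans _ _ ((1 + A) ^+ n))//.
    by rewrite lerXn2r ?nnegrE ?addr_ge0// lerDr.
  by rewrite ler_weXn2l// lerDl.
pose f1 s := \sum_k component k w * partial k f (p + s *: w).
pose f2 s := \sum_k component k w *
  \sum_l component l w * partial l (partial k f) (p + s *: w).
pose f3 s := \sum_k component k w * \sum_l component l w *
  \sum_j component j w * partial j (partial l (partial k f)) (p + s *: w).
have D0 s : 0 <= s <= h -> is_derive s 1 (fun s => f (p + s *: w)) (f1 s).
  by move=> /lineU; exact: is_derive_line_C1.
have D1 s : 0 <= s <= h -> is_derive s 1 f1 (f2 s).
  by move=> /lineU Us; apply: is_derive_lincomb => k; exact: is_derive_line_C1 Us.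
have D2 s : 0 <= s <= h -> is_derive s 1 f2 (f3 s).
  move=> /lineU Us; apply: is_derive_lincomb => k; apply: is_derive_lincomb => l.
  exact: is_derive_line_C1 Us.
have B1 s : 0 <= s <= h -> `|f1 s| <= A * M.
  by move=> /lineU Us; apply: le_norm_lincomb => // k; exact: M1.
have B2 s : 0 <= s <= h -> `|f2 s| <= A * (A * M).
  move=> /lineU Us; apply: le_norm_lincomb => // k.
  by apply: le_norm_lincomb => // l; exact: M2.
have B3 s : 0 <= s <= h -> `|f3 s| <= A * (A * (A * M)).
  move=> /lineU Us; apply: le_norm_lincomb => // k.
  apply: le_norm_lincomb => // l.
  by apply: le_norm_lincomb => // j; exact: M3.
have in0 : 0 <= (0 : R) <= h by rewrite lexx.
have E s : p + 0 *: w = p by rewrite scale0r addr0.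
exists (f2 0 / 2); split.
- by rewrite (le_trans (M0 _ Up))//; have := leK 0%N; rewrite expr0 mul1r; apply.
- have := B1 _ in0; rewrite /f1 scale0r addr0 => /le_trans; apply.
  by have := leK 1%N; rewrite expr1; apply.
- have := B2 _ in0; have := leK 2 isT; rewrite expr2 -mulrA => le2 B.
  rewrite normrM [`|2^-1|]ger0_norm// (le_trans _ le2)// (le_trans _ B)//.
  by rewrite ler_piMr// invf_le1// ler1n.
move=> s sh; have C0' : 0 <= A * (A * (A * M)) by rewrite !mulr_ge0.
have := taylor2_bound C0' D0 D1 D2 B3 sh.
rewrite {1}/f1 !scale0r !addr0 => /le_trans; apply; rewrite ler_wpM2r//.
  by rewrite exprn_ge0//; case/andP: sh.
by have := leK 3 isT; rewrite !exprS expr0 mulr1 -!mulrA.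
Qed.

End line_expansion.

(** * Consistency when the backward path stays in the open cylinder *)

Section interior_estimate.
Context {R : realType} {d : nat}.
Local Notation point := ('cV[R]_d * R)%type.
Variables (Omega : set 'cV[R]_d) (T : R).
Hypotheses (Omega_open : open Omega) (T_gt0 : 0 < T)
  (Omega_bounded : bounded_set Omega).
Local Notation cyl := (cylinder Omega T).
Implicit Types (u : point -> 'cV[R]_d) (z : point -> 'M[R]_d) (x : 'cV[R]_d).

Lemma finite_bound (I : finType) (P : I -> R -> Prop) :
  (forall i M M', M <= M' -> P i M -> P i M') -> (forall i, exists M, P i M) ->
  exists M, forall i, P i M.
Proof.
move=> Pmono /choice[M PM]; exists (\big[Num.max/0]_i M i) => i.
by apply: Pmono (PM i); exact: le_bigmax.
Qed.

Lemma finite_family_bound (I : finType) (D : set point) (g : I -> point -> R) :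
  (forall i, exists M : R, forall p, D p -> `|g i p| <= M) ->
  exists M : R, forall i p, D p -> `|g i p| <= M.
Proof.
apply: finite_bound => i M M' MM' gM p /gM /le_trans; exact.
Qed.

(** Space-time velocity of the straight path [(foot u s x t, t - s)], frozen at its starting point
    [p]. *)
Definition direction u (p : point) : point := (- u p, -1).

Lemma foot_line u x t s :
  (foot u s x t, t - s) = (x, t) + s *: direction u (x, t).
Proof.
rewrite /foot /direction; congr pair => /=; first by rewrite scalerN.
by rewrite /GRing.scale /= mulrN mulr1.
Qed.

Lemma mulmx_trE (A B C : 'M[R]_d) i j :
  (A *m B *m C^T) i j = \sum_l (\sum_k A i k * B k l) * C j l.
Proof. by rewrite mxE; apply: eq_bigr => l _; rewrite mxE [C^T l j]mxE. Qed.

(** The curve Z(s) of the opening idea; the scheme combines its values at 0, [dt] and [2 * dt]. *)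
Definition transported u z x t (s : R) : 'M[R]_d :=
  deformation Omega T u s x t *m z (foot u s x t, t - s)
  *m (deformation Omega T u s x t)^T.

(** Entrywise the curve is a sum of products of affine functions of [s] with entries of [z] along a
    line, so its expansion follows from those of the factors. The constant comes from bounds over
    the whole cylinder, hence serves all [h], [x], [t] at once. *)
Lemma transported_expansion u z :
  (forall i, smooth_upto_boundary Omega T 3 (fun p => u p i 0)) ->
  (forall i j, smooth_upto_boundary Omega T 3 (fun p => z p i j)) ->
  exists K, forall h x t i j, 0 <= h <= T ->
    (forall s, 0 <= s <= h -> cyl ((x, t) + s *: direction u (x, t))) ->
    expansion K h (fun s => transported u z x t s i j) (z (x, t) i j)
      (- upper_convected Omega T u z (x, t) i j).
Proof.
move=> su sz.
have [W uW] : exists W : R, forall i p, cyl p -> `|u p i 0| <= W.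
  by apply: finite_family_bound => i; exact: (smooth_bounded (s := [::])) (su i) _.
have [G gG] : exists G : R, forall ij p, cyl p ->
    `|gradient Omega T u p ij.1 ij.2| <= G.
  apply: finite_family_bound => -[i j] /=.
  have [M HM] := smooth_bounded (s := [:: Some j]) Omega_bounded (su i) isT.
  exists M => p cp; rewrite mxE.
  have [_ ->//] := bpartial_ext T_gt0 (Some j) (su i).
  exact: HM.
(* Indexing by an entry and three axes makes the family finite, so a single [M] bounds all entries
   and their partial derivatives up to order three. *)
have [M zM] : exists M : R, forall
    (q : 'I_d * 'I_d * (option 'I_d * option 'I_d * option 'I_d)) p, cyl p ->
    let f p := z p q.1.1 q.1.2 in
    [/\ `|f p| <= M, `|partial q.2.1.1 f p| <= M,
        `|partial q.2.1.2 (partial q.2.1.1 f) p| <= M &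
        `|partial q.2.2 (partial q.2.1.2 (partial q.2.1.1 f)) p| <= M].
  apply: finite_bound => [ij M M' MM' zM p /zM [H0 H1 H2 H3]|].
    by split; [exact: le_trans H0 MM'|exact: le_trans H1 MM'|
               exact: le_trans H2 MM'|exact: le_trans H3 MM'].
  move=> [[i j] [[k l] r]] /=.
  have [M0 H0] := smooth_bounded (s := [::]) Omega_bounded (sz i j) isT.
  have [M1 H1] := smooth_bounded (s := [:: k]) Omega_bounded (sz i j) isT.
  have [M2 H2] := smooth_bounded (s := [:: l; k]) Omega_bounded (sz i j) isT.
  have [M3 H3] := smooth_bounded (s := [:: r; l; k]) Omega_bounded (sz i j) isT.
  exists (Num.max (Num.max M0 M1) (Num.max M2 M3)) => p cp.
  split; rewrite !le_max.
  - by have /= -> := H0 _ cp.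
  - by have /= -> := H1 _ cp; rewrite orbT.
  - by have /= -> := H2 _ cp; rewrite !orbT.
  - by have /= -> := H3 _ cp; rewrite !orbT.
(* In [KL] the 1 bounds the entries of the identity; in [1 + W] it bounds the time component -1 of
   [direction]. *)
pose KL := 1 + G; pose KZ := M * (1 + d.+1%:R * (1 + W)) ^+ 3.
pose C := 4 + 3 * T + 2 * T ^+ 2 + T ^+ 3.
exists (d%:R * (d%:R * (KL * KZ * C) * KL * C)) => h x t i j /andP[h0 hT] line.
set p := (x, t); set v := direction u p.
have cp : cyl p by have := line 0; rewrite scale0r addr0; apply; rewrite lexx.
pose Dz k l := \sum_m component m v * partial m (fun p => z p k l) p.
have zE k l : expansion KZ h (fun s => z (p + s *: v) k l) (z p k l) (Dz k l).
  apply: (expansion_line (U := cyl)) => //; first exact: open_cylinder.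
  - exact: (smooth_C1 (s := [::]) Omega_open (sz k l)).
  - by move=> m; exact: (smooth_C1 (s := [:: m]) Omega_open (sz k l)).
  - by move=> m n; exact: (smooth_C1 (s := [:: n; m]) Omega_open (sz k l)).
  - have W0 : 0 <= W by have := uW i _ cp; exact: le_trans.
    case=> [m|] /=; last by rewrite normrN normr1 lerDl.
    by rewrite mxE normrN (le_trans (uW _ _ cp))// lerDr.
  - by move=> q /(zM ((k, l), ((None, None), None))) [H _ _ _]; exact: H.
  - by move=> m q /(zM ((k, l), ((m, None), None))) [_ H _ _]; exact: H.
  - by move=> m n q /(zM ((k, l), ((m, n), None))) [_ _ H _]; exact: H.
  - by move=> m n r q /(zM ((k, l), ((m, n), r))) [_ _ _ H]; exact: H.
have LE k l : expansion KL h (fun s => deformation Omega T u s x t k l)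
    ((1%:M : 'M[R]_d) k l) (gradient Omega T u p k l).
  have -> : (fun s => deformation Omega T u s x t k l) =
      (fun s => (1%:M : 'M[R]_d) k l + s * gradient Omega T u p k l).
    by apply/funext => s; rewrite /deformation !mxE.
  have G0 : 0 <= G by have := gG (k, l) _ cp; exact: le_trans.
  apply: expansion_affine; last by rewrite (le_trans (gG (k, l) _ cp))// lerDr.
  by rewrite mxE; case: (k == l); rewrite ?normr1 ?normr0 ?lerDl// addr_ge0.
(* The nesting follows [mulmx_trE]: the inner sum is the product of the deformation with [z], the
   outer one multiplies by the transpose. [T] serves as the uniform bound [H]. *)
have := expansion_sum (fun l => expansion_mul (ltW T_gt0) hT
  (expansion_sum (fun k => expansion_mul (ltW T_gt0) hT (LE i k) (zE k l)))
  (LE j l)).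
rewrite big_split /= -!mulmx_trE trmx1 mulmx1 mul1mx -/C.
have -> : (fun s => \sum_l (\sum_k deformation Omega T u s x t i k *
    z (p + s *: v) k l) * deformation Omega T u s x t j l) =
    (fun s => transported u z x t s i j).
  by apply/funext => s; rewrite /transported foot_line mulmx_trE.
set Gp := gradient Omega T u p; pose DZ := \matrix_(k, l) Dz k l.
have -> : \sum_l (\sum_k ((1%:M : 'M[R]_d) i k * Dz k l + Gp i k * z p k l)) *
    (1%:M : 'M[R]_d) j l = (DZ + Gp *m z p) i j.
  transitivity (((1%:M *m DZ + Gp *m z p) *m (1%:M)^T) i j); last first.
    by rewrite trmx1 mulmx1 mul1mx.
  rewrite [RHS]mxE; apply: eq_bigr => l _; rewrite [_^T l j]mxE; congr (_ * _).
  rewrite [RHS]mxE [(1%:M *m DZ) i l]mxE [(Gp *m z p) i l]mxE -big_split /=.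
  by apply: eq_bigr => k _; rewrite [DZ k l]mxE.
suff -> : - upper_convected Omega T u z p i j =
    (z p *m Gp^T) i j + (DZ + Gp *m z p) i j by [].
rewrite /upper_convected -/Gp.
(* Along a direction with components [- u] and -1, the derivative of [z] is minus its material
   derivative. *)
have DZE : DZ = - (time_derivative Omega T z p + advection Omega T u z p).
  apply/matrixP => k l; rewrite !mxE /Dz sum_axes /= opprD mulN1r.
  have bE m : bpartial Omega T m (fun q => z q k l) p =
      partial m (fun q => z q k l) p.
    by have [_ ->] := bpartial_ext T_gt0 m (sz k l).
  rewrite bE -sumrN; congr (_ + _); apply: eq_bigr => m _.
  by rewrite bE mxE mulNr.
rewrite DZE !mxE; ring.
Qed.

Lemma bdf2_interior_consistency u z :
  (forall i, smooth_upto_boundary Omega T 3 (fun p => u p i 0)) ->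
  (forall i j, smooth_upto_boundary Omega T 3 (fun p => z p i j)) ->
  exists K, forall dt x t i j, 0 < dt -> 2 * dt <= T ->
    (forall s, 0 <= s <= 2 * dt -> cyl ((x, t) + s *: direction u (x, t))) ->
    `|(upper_convected Omega T u z (x, t)
       - bdf2_upper_convected Omega T u z dt x t) i j| <= 6 * K * dt ^+ 2.
Proof.
move=> su sz; have [K KP] := transported_expansion su sz.
exists K => dt x t i j dt0 dtT line.
pose f s := transported u z x t s i j.
have f0 : f 0 = z (x, t) i j.
  rewrite /f /transported foot_line /deformation !scale0r !addr0.
  by rewrite trmx1 mulmx1 mul1mx.
have dt20 : 0 <= 2 * dt <= T by rewrite dtT andbT mulr_ge0// ltW.
have := bdf2_consistency dt0 f0 (KP _ _ _ i j dt20 line).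
rewrite opprK; congr (`|_| <= _); rewrite f0 /f /transported.
by rewrite /bdf2_upper_convected !mxE.
Qed.

End interior_estimate.

(** * From the essential supremum to a pointwise gradient bound *)

Section essential_supremum_bound.
Context {R : realType}.
Local Notation RR := (measurableTypeR R).

Lemma cvg_sumr (I X : Type) (r : seq I) (F : set_system X) {FF : Filter F}
    (f : I -> X -> R) (a : I -> R) :
  (forall i, f i x @[x --> F] --> a i) ->
  \sum_(i <- r) f i x @[x --> F] --> \sum_(i <- r) a i.
Proof.
move=> fa; elim: r => [|i r IH].
  by under eq_fun do rewrite big_nil; rewrite big_nil; exact: cvg_cst.
by under eq_fun do rewrite big_cons; rewrite big_cons; exact: cvgD.
Qed.

Lemma cvg_frobenius (X : Type) (F : set_system X) {FF : Filter F} m n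
    (A : X -> 'M[R]_(m, n)) (B : 'M[R]_(m, n)) :
  (forall i j, A x i j @[x --> F] --> B i j) ->
  frobenius (A x) @[x --> F] --> frobenius B.
Proof.
move=> AB; apply: (continuous_cvg _ (@sqrt_continuous R _)).
apply: cvg_sumr => i; apply: cvg_sumr => j.
exact: (continuous_cvg _ (@exprn_continuous R 2 _)).
Qed.

(** Induction along the recursion of the measure: an interval times a smaller cube, with measures
    multiplying; in dimension 0 the only point has Dirac mass 1. *)
Lemma lebesgue_tuple_cube n (c : 'I_n -> R) (e : R) : 0 < e ->
  exists B : set (n.-tuple RR), [/\ measurable B, (0 < lebesgue_tuple R n B)%E &
    forall v, B v -> forall i, `|c i - tnth v i| < e].
Proof.
move=> e0; elim: n c => [|n IH] c.
  exists setT; split; [exact: measurableT| |by move=> v _ []].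
  by rewrite /= diracT lte01.
have [B [mB B0 Bc]] := IH (fun i => c (lift ord0 i)).
have mI : measurable (ball (c ord0) e : set RR).
  by rewrite ball_itv; exact: measurable_itv.
have I0 : (0 < @lebesgue_measure R (ball (c ord0) e))%E.
  by rewrite lebesgue_measure_ball ?ltW// lte_fin pmulrn_lgt0.
exists (@tuple_uncons R n @^-1` (ball (c ord0) e `*` B)); split.
- rewrite -[X in measurable X]setTI.
  by apply: measurable_tuple_uncons => //; exact: measurableX.
- rewrite /= /cons_measure /pushforward -comp_preimage.
  rewrite (_ : _ \o _ = id) ?preimage_id; last first.
    by apply/funext => p; exact: tuple_consK.
  by rewrite product_measure1E// mule_gt0.
- move=> v [/= v0 vB] i; have [j|] := unliftP ord0 i => ->; last exact: v0.
  have := Bc _ vB j; congr (`|_ - _| < e).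
  by rewrite [in RHS](tuple_eta v) tnthS.
Qed.

Context {d : nat}.
Local Notation point := ('cV[R]_d * R)%type.
Variables (Omega : set 'cV[R]_d) (T : R).
Hypotheses (Omega_open : open Omega) (T_gt0 : 0 < T).
Local Notation cyl := (cylinder Omega T).

Lemma gradient_continuous m (u : point -> 'cV[R]_d) p i j :
  (forall i, smooth_upto_boundary Omega T m.+1 (fun p => u p i 0)) -> cyl p ->
  {for p, continuous (fun q => gradient Omega T u q i j)}.
Proof.
move=> su cp; have [cb _] := bpartial_ext T_gt0 (Some j) (su i).
have gE : bpartial Omega T (Some j) (fun q => u q i 0) =
    (fun q => gradient Omega T u q i j) by apply/funext => q; rewrite mxE.
by rewrite /prop_for -gE; exact: within_ccylinder_continuous cb cp.
Qed.

(* A continuous function cannot exceed its essential supremum, since every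
   neighbourhood contains a cube of positive measure. *)
Lemma frobenius_gradient_le_seminorm m (u : point -> 'cV[R]_d) p :
  (forall i, smooth_upto_boundary Omega T m.+1 (fun p => u p i 0)) -> cyl p ->
  ((frobenius (gradient Omega T u p))%:E <= seminorm_C0W1oo Omega T u)%E.
Proof.
move=> su; case: p => x t cp.
have [/= Ox tT] := cp.
set f := fun y => (frobenius (gradient Omega T u (@col_of_tuple R d y, t)))%:E.
set g := patch (fun=> -oo%E) (@col_of_tuple R d @^-1` Omega) f.
apply: (@le_trans _ _ (ess_sup (lebesgue_tuple R d) g)); last first.
  by apply: ereal_sup_ubound; exists t => //; exact: subset_itv_oo_cc.
(* [y] is an almost everywhere upper bound, exceeded only inside the null set [N]. Were it below the
   value at the given point, a whole cube would lie in [N]. *)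
apply: le_ereal_inf_tmp => y [N [mN N0 gN]]; rewrite leNgt; apply/negP => yF.
have nearF : \forall q \near (x, t), Omega q.1 /\
    (y < (frobenius (gradient Omega T u q))%:E)%E.
  near=> q; split.
    suff : cyl q by case.
    by near: q; apply: open_nbhs_nbhs; split => //; exact: open_cylinder.
  near: q; case: y gN yF => [r| |]// _; last first.
    by move=> _; apply: nearW => q; exact: ltNyr.
  move=> yF; have rF : r < frobenius (gradient Omega T u (x, t)).
    by rewrite -lte_fin.
  have cF : frobenius (gradient Omega T u q) @[q --> (x, t)] -->
      frobenius (gradient Omega T u (x, t)).
    by apply: cvg_frobenius => i j; exact: (gradient_continuous su cp).
  by apply: filterS (cvgr_gt _ cF _ rF) => q; rewrite lte_fin.
have /nbhs_ballP[e /= e0 eF] := nearF.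
have [B [mB B0 Bx]] := lebesgue_tuple_cube (fun i => x i 0) e0.
have BN : B `<=` N.
  move=> v Bv; apply: gN => /=; apply/negP; rewrite -ltNge.
  have [|/= Ov yv] := eF (@col_of_tuple R d v, t).
    split => /=; last exact: ballxx.
    split => // i j; rewrite mxE ord1; exact: Bx.
  by rewrite /g /patch mem_set.
by have := subset_measure0 mB mN BN N0; move: B0 => /[swap] ->; rewrite ltxx.
Unshelve. all: by end_near. Qed.

End essential_supremum_bound.

(** * The backward segment does not leave the domain *)

Section foot.
Context {R : realType} {d : nat}.
Local Notation point := ('cV[R]_d * R)%type.
Variables (Omega : set 'cV[R]_d) (T : R).
Hypotheses (Omega_open : open Omega) (T_gt0 : 0 < T).
Local Notation cyl := (cylinder Omega T).
Local Notation ccyl := (ccylinder Omega T).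

Lemma cvg_comp_within (X : Type) (F : set_system X) {FF : Filter F}
    (D : set point) (g : X -> point) (f : point -> R) p :
  {within D, continuous f} -> D p -> (\forall x \near F, D (g x)) ->
  g x @[x --> F] --> p -> f (g x) @[x --> F] --> f p.
Proof.
move=> /subspace_continuousP cf /cf fp Dg gp.
apply: cvg_trans fp => W /= /gp /= gW.
by apply: filterS2 Dg gW => y Dy; apply.
Qed.

Lemma frobenius_sqr m n (A : 'M[R]_(m, n)) :
  frobenius A ^+ 2 = \sum_i \sum_j A i j ^+ 2.
Proof.
rewrite sqr_sqrtr// sumr_ge0// => i _.
by rewrite sumr_ge0// => j _; rewrite sqr_ge0.
Qed.

(** Cauchy-Schwarz by completing the square: with N = |v|^2, the sum of the squares of N A_ij - v_i
    v_j equals N^2 (|A|^2 - 1), which is negative unless N = 0. *)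
Lemma quadratic_form_fixed (v : 'cV[R]_d) (A : 'M[R]_d) :
  \sum_i \sum_j A i j ^+ 2 < 1 ->
  \sum_i v i 0 ^+ 2 = \sum_i \sum_j A i j * (v i 0 * v j 0) -> v = 0.
Proof.
set N := \sum_i v i 0 ^+ 2; move=> A1 NE.
have N2 : \sum_i \sum_j (v i 0 * v j 0) ^+ 2 = N ^+ 2.
  rewrite expr2 /N mulr_suml; apply: eq_bigr => i _.
  by rewrite mulr_sumr; apply: eq_bigr => j _; rewrite exprMn.
have ND : N = \sum_i v i 0 ^+ 2 by []; clearbody N.
have : 0 <= \sum_i \sum_j (N * A i j - v i 0 * v j 0) ^+ 2.
  by rewrite sumr_ge0// => i _; rewrite sumr_ge0// => j _; rewrite sqr_ge0.
have -> : \sum_i \sum_j (N * A i j - v i 0 * v j 0) ^+ 2 =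
    N ^+ 2 * (\sum_i \sum_j A i j ^+ 2 - 1).
  transitivity (N ^+ 2 * (\sum_i \sum_j A i j ^+ 2) -
      2 * N * (\sum_i \sum_j A i j * (v i 0 * v j 0)) +
      \sum_i \sum_j (v i 0 * v j 0) ^+ 2); last by rewrite N2 -NE; ring.
  rewrite !mulr_sumr -sumrB -big_split; apply: eq_bigr => i _ /=.
  rewrite !mulr_sumr -sumrB -big_split; apply: eq_bigr => j _ /=; ring.
move=> N0; have {}N0 : N = 0.
  apply/eqP; rewrite -sqrf_eq0 -[_ == 0]negbK; apply/negP => N20.
  have : 0 < N ^+ 2 by rewrite lt_neqAle eq_sym N20 sqr_ge0.
  by move=> /pmulr_rge0; move: N0 => /[swap] ->; lra.
apply/colP => i; rewrite mxE; apply/eqP; rewrite -sqrf_eq0; apply/eqP.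
by move: N0; rewrite ND => /psumr_eq0P; apply => // k _; exact: sqr_ge0.
Qed.

(* At the first exit point [x - s0 v], with [v = u (x, t)], the velocity
   vanishes; the mean value theorem applied to [v . u] on the segment then gives
   [|v|^2 = s0 v^T (grad u) v <= |v|^2 / 2], hence [v = 0]. *)
Lemma segment_in_domain m (u : point -> 'cV[R]_d) x t (h : R) :
  (forall i, smooth_upto_boundary Omega T m.+1 (fun p => u p i 0)) ->
  (forall y, (closure Omega `\` Omega°) y -> u (y, t) = 0) ->
  (forall p, cyl p -> h * frobenius (gradient Omega T u p) <= 1 / 2) ->
  cyl (x, t) -> forall s, 0 <= s <= h -> Omega (x - s *: u (x, t)).
Proof.
move=> su u0 hF cxt s1 s1h; have [/= Ox tT] := cxt.
set v := u (x, t).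
have v0P : v = 0 -> Omega (x - s1 *: v) by move=> ->; rewrite scaler0 subr0.
apply: contrapT => nO.
pose gam s : 'cV[R]_d := x - s *: v.
have cgam : continuous gam.
  by move=> s; apply: cvgB; [exact: cvg_cst|apply: cvgZr_tmp; exact: cvg_id].
(* The first exit time is the minimum of the compact set of parameters whose point is outside the
   open set [Omega]. *)
have [s0 [s0h s0O] s0min] : exists2 s0, 0 <= s0 <= h /\ ~ Omega (gam s0) &
    forall s, 0 <= s < s0 -> Omega (gam s).
  have cS : compact (`[0, h]%classic `&` gam @^-1` (~` Omega)).
    apply: compact_closedI; first exact: segment_compact.
    by apply: preimage_closed => [s _|]; [exact: cgam|exact: open_closedC].
  have S0 : (`[0, h]%classic `&` gam @^-1` (~` Omega)) !=set0.
    by exists s1; split => //=; rewrite in_itv.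
  have cid : {within `[0, h]%classic `&` gam @^-1` (~` Omega),
      continuous (@idfun R)}.
    by apply: continuous_subspaceT => s; exact: cvg_id.
  have [s0 + s0min] := compact_EVT_min S0 cS cid.
  rewrite inE => -[/=]; rewrite in_itv /= => s0h s0O.
  exists s0 => // s /andP[ss0 ltss0].
  apply: contrapT => nOs; have : s0 <= s.
    apply: s0min; rewrite inE; split => //=; rewrite in_itv /= ss0.
    by rewrite (le_trans (ltW ltss0))//; case/andP: s0h.
  by rewrite leNgt ltss0.
have {s0h}/andP[s0ge0 s0h] := s0h.
have s0gt0 : 0 < s0.
  rewrite lt_neqAle s0ge0 andbT; apply/eqP => s00; apply: s0O.
  by rewrite -s00 /gam scale0r subr0.
have cly : closure Omega (gam s0).
  apply: (@closed_cvg _ _ (s0^'-) _ gam (closure Omega)).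
  - exact: closed_closure.
  - near=> s; apply: subset_closure; apply: s0min; apply/andP; split.
      by near: s; apply: nbhs_left_ge.
    by near: s; exact: nbhs_left_lt.
  - exact: cvg_at_left_filter (cgam s0).
have uy : u (gam s0, t) = 0.
  by apply: u0; split => // /interior_subset.
pose w : point := (- v, 0).
have pathE s : (x, t) + s *: w = (gam s, t).
  by congr pair => /=; rewrite ?scalerN// scaler0 addr0.
(* This scalar product of [v] with the velocity falls from |v|^2 at 0 to 0 at the exit time. *)
pose theta s := \sum_i v i 0 * u ((x, t) + s *: w) i 0.
pose dtheta s := \sum_i v i 0 *
  \sum_k component k w * partial k (fun p => u p i 0) ((x, t) + s *: w).
have Dtheta s : s \in `]0, s0[ -> is_derive s 1 theta (dtheta s).
  rewrite in_itv /= => /andP[sgt0 slt]; apply: is_derive_lincomb => i.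
  apply: is_derive_line_C1 (open_cylinder Omega_open) _ _.
    exact: (smooth_C1 (s := [::]) Omega_open (su i)).
  by rewrite pathE; split => //=; apply: s0min; rewrite ltW.
(* The end of the path is outside the open cylinder, so continuity is taken within the closed
   one. *)
have ctheta : {within `[0, s0], continuous theta}.
  apply/subspace_continuousP => s ss0; apply: cvg_sumr => i.
  have inccyl r : r \in `[0, s0] -> ccyl ((x, t) + r *: w).
    rewrite in_itv /= => /andP[r0]; rewrite le_eqVlt pathE => /predU1P[->|rs].
      by split => //=; exact: subset_itv_oo_cc.
    split => /=; last exact: subset_itv_oo_cc.
    by apply/subset_closure/s0min; rewrite r0.
  apply: cvgMl_tmp; have [cu _ _] := su i.
  apply: (cvg_comp_within cu); first exact: inccyl.
    by rewrite near_withinE; apply: nearW => r; exact: inccyl.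
  apply: cvg_within_filter; apply: cvgD; first exact: cvg_cst.
  by apply: cvgZr_tmp; exact: cvg_id.
have [c cs0] := MVT s0gt0 Dtheta ctheta.
rewrite /theta pathE uy scale0r addr0 subr0 /dtheta.
rewrite [X in X - _]big1 ?sub0r => [|i _]; last by rewrite mxE mulr0.
have cc : cyl ((x, t) + c *: w).
  move: cs0; rewrite in_itv /= => /andP[c0 cs]; rewrite pathE; split => //=.
  by apply: s0min; rewrite ltW.
set G := gradient Omega T u ((x, t) + c *: w) => MVTE.
suff v0 : v = 0 by exact: nO (v0P v0).
(* The mean value identity says that |v|^2 is the quadratic form of [s0 *: G] at [v], and this
   matrix has Frobenius norm at most 1/2. *)
apply: (@quadratic_form_fixed v (s0 *: G)).
- have F0 : 0 <= frobenius G by exact: sqrtr_ge0.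
  have sF : s0 * frobenius G <= 1 / 2.
    by rewrite (le_trans _ (hF _ cc))// ler_wpM2r.
  have -> : \sum_i \sum_j (s0 *: G) i j ^+ 2 = (s0 * frobenius G) ^+ 2.
    rewrite exprMn frobenius_sqr mulr_sumr; apply: eq_bigr => i _.
    by rewrite mulr_sumr; apply: eq_bigr => j _; rewrite mxE exprMn.
  by rewrite -[ltRHS](expr1n _ 2) ltrXn2r// ?nnegrE ?mulr_ge0//; lra.
- transitivity (\sum_i v i 0 * v i 0).
    by apply: eq_bigr => i _; rewrite expr2.
  apply: oppr_inj; rewrite MVTE mulr_suml -sumrN; apply: eq_bigr => i _.
  rewrite sum_axes /= mul0r add0r mulr_sumr mulr_suml -sumrN.
  apply: eq_bigr => j _; rewrite !mxE.
  have [_ ->//] := bpartial_ext T_gt0 (Some j) (su i).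
  ring.
Unshelve. all: by end_near. Qed.

End foot.

(** * Continuity of both sides of the estimate up to the boundary *)

Section limit.
Context {R : realType}.

Lemma cvg_mx (X : Type) (F : set_system X) {FF : Filter F} m n
    (A : X -> 'M[R]_(m, n)) (B : 'M[R]_(m, n)) :
  (forall i j, A x i j @[x --> F] --> B i j) -> A x @[x --> F] --> B.
Proof.
move=> AB; apply/cvg_ballP => e e0.
have nearAB i : \forall x \near F, forall j, ball (B i j) e (A x i j).
  by apply: filter_forall => j; move/cvg_ballP: (AB i j); exact.
have Fball := filter_forall FF nearAB.
by apply: filterS Fball => q Aq; split.
Qed.

Lemma cvg_entry (X : Type) (F : set_system X) {FF : Filter F} m n
    (A : X -> 'M[R]_(m, n)) (B : 'M[R]_(m, n)) i j :
  A x @[x --> F] --> B -> A x i j @[x --> F] --> B i j.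
Proof.
by move=> AB; exact: (cvg_comp _ _ AB (@coord_continuous R m n i j B)).
Qed.

Lemma cvg_mulmx (X : Type) (F : set_system X) {FF : Filter F} m n p
    (A : X -> 'M[R]_(m, n)) (B : X -> 'M[R]_(n, p))
    (A0 : 'M[R]_(m, n)) (B0 : 'M[R]_(n, p)) :
  A x @[x --> F] --> A0 -> B x @[x --> F] --> B0 ->
  A x *m B x @[x --> F] --> A0 *m B0.
Proof.
move=> AA BB; apply: cvg_mx => i j; rewrite mxE; under eq_fun do rewrite mxE.
by apply: cvg_sumr => k; apply: cvgM; exact: cvg_entry.
Qed.

Lemma cvg_trmx (X : Type) (F : set_system X) {FF : Filter F} m n
    (A : X -> 'M[R]_(m, n)) (A0 : 'M[R]_(m, n)) :
  A x @[x --> F] --> A0 -> (A x)^T @[x --> F] --> A0^T.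
Proof. by move=> AA; exact: (cvg_comp _ _ AA (@trmx_continuous R m n A0)). Qed.

Context {d : nat}.
Local Notation point := ('cV[R]_d * R)%type.
Variables (Omega : set 'cV[R]_d) (T : R).
Hypotheses (Omega_open : open Omega) (T_gt0 : 0 < T).
Local Notation cyl := (cylinder Omega T).
Local Notation ccyl := (ccylinder Omega T).

Lemma closed_ccylinder : closed ccyl.
Proof.
have -> : ccyl = fst @^-1` (closure Omega) `&` snd @^-1` `[0, T]%classic.
  by apply/seteqP; split=> -[x t] [].
apply: closedI; apply: preimage_closed => [p _|].
- exact: cvg_fst.
- exact: closed_closure.
- exact: cvg_snd.
- exact: interval_closed.
Qed.

Section scheme_limit.
Variables (m : nat) (u : point -> 'cV[R]_d) (z : point -> 'M[R]_d).
Hypotheses (su : forall i, smooth_upto_boundary Omega T m.+1 (fun p => u p i 0))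
  (sz : forall i j, smooth_upto_boundary Omega T m.+1 (fun p => z p i j)).
Context {X : Type} {F : set_system X} {FF : ProperFilter F}.

Section along_filter.
Variables (g : X -> point) (p : point).
Hypotheses (gp : g x @[x --> F] --> p) (gccyl : \forall x \near F, ccyl (g x)).

Let ccyl_lim : ccyl p.
Proof. exact: (@closed_cvg _ _ F _ g ccyl closed_ccylinder gccyl p gp). Qed.

Lemma cvg_velocity : u (g x) @[x --> F] --> u p.
Proof.
apply: cvg_mx => i j; rewrite ord1; have [cu _ _] := su i.
exact: (cvg_comp_within cu ccyl_lim gccyl gp).
Qed.

Lemma cvg_tensor : z (g x) @[x --> F] --> z p.
Proof.
apply: cvg_mx => i j; have [cz _ _] := sz i j.
exact: (cvg_comp_within cz ccyl_lim gccyl gp).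
Qed.

Lemma cvg_gradient : gradient Omega T u (g x) @[x --> F] --> gradient Omega T u p.
Proof.
apply: cvg_mx => i j; rewrite mxE; under eq_fun do rewrite mxE.
have [cu _] := bpartial_ext T_gt0 (Some j) (su i).
exact: (cvg_comp_within cu ccyl_lim gccyl gp).
Qed.

Lemma cvg_upper_convected :
  upper_convected Omega T u z (g x) @[x --> F] --> upper_convected Omega T u z p.
Proof.
have cz k i j : bpartial Omega T k (fun q => z q i j) (g x) @[x --> F] -->
    bpartial Omega T k (fun q => z q i j) p.
  have [cz _] := bpartial_ext T_gt0 k (sz i j).
  exact: (cvg_comp_within cz ccyl_lim gccyl gp).
apply: cvgB; [apply: cvgB; [apply: cvgD|]|].
- apply: cvg_mx => i j; rewrite mxE; under eq_fun do rewrite mxE.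
  exact: cz.
- apply: cvg_mx => i j; rewrite mxE; under eq_fun do rewrite mxE.
  apply: cvg_sumr => k; apply: cvgM; last exact: cz.
  exact: (cvg_entry (i := k) (j := 0) cvg_velocity).
- exact: cvg_mulmx cvg_gradient cvg_tensor.
- exact: cvg_mulmx cvg_tensor (cvg_trmx cvg_gradient).
Qed.

End along_filter.

(** The step varies along the filter as well, since approximating a boundary time shrinks it. The
    point and both feet must stay in the closed cylinder because continuity of the data is known
    only within it. *)
Lemma cvg_bdf2_upper_convected (dt : X -> R) (x : X -> 'cV[R]_d) (t : X -> R)
    (dt0 : R) (x0 : 'cV[R]_d) (t0 : R) : dt0 != 0 ->
  dt q @[q --> F] --> dt0 -> x q @[q --> F] --> x0 -> t q @[q --> F] --> t0 ->
  (\forall q \near F, ccyl (x q, t q)) ->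
  (\forall q \near F, ccyl (foot u (dt q) (x q) (t q), t q - dt q)) ->
  (\forall q \near F, ccyl (foot u (2 * dt q) (x q) (t q), t q - 2 * dt q)) ->
  bdf2_upper_convected Omega T u z (dt q) (x q) (t q) @[q --> F] -->
    bdf2_upper_convected Omega T u z dt0 x0 t0.
Proof.
move=> dt00 cdt cx ct cp cf1 cf2.
have cp0 : (x q, t q) @[q --> F] --> (x0, t0).
  exact: (cvg_pair cx ct).
have cdt2 : 2 * dt q @[q --> F] --> 2 * dt0.
  by apply: cvgM; [exact: cvg_cst|exact: cdt].
have cfoot (h : X -> R) h0 : h q @[q --> F] --> h0 ->
    foot u (h q) (x q) (t q) @[q --> F] --> foot u h0 x0 t0.
  by move=> ch; apply: cvgB => //; apply: cvgZ => //; exact: cvg_velocity cp0 cp.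
have cdef (h : X -> R) h0 : h q @[q --> F] --> h0 ->
    deformation Omega T u (h q) (x q) (t q) @[q --> F] -->
      deformation Omega T u h0 x0 t0.
  move=> ch; apply: cvgD; first exact: cvg_cst.
  by apply: cvgZ => //; exact: cvg_gradient cp0 cp.
have ctr (h : X -> R) h0 : h q @[q --> F] --> h0 ->
    (\forall q \near F, ccyl (foot u (h q) (x q) (t q), t q - h q)) ->
    deformation Omega T u (h q) (x q) (t q) *m
      z (foot u (h q) (x q) (t q), t q - h q) *m
      (deformation Omega T u (h q) (x q) (t q))^T @[q --> F] -->
    deformation Omega T u h0 x0 t0 *m z (foot u h0 x0 t0, t0 - h0) *m
      (deformation Omega T u h0 x0 t0)^T.
  move=> ch cf; apply: cvg_mulmx; last exact: (cvg_trmx (cdef _ _ ch)).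
  apply: cvg_mulmx; first exact: (cdef _ _ ch).
  apply: (cvg_tensor (g := fun q => (foot u (h q) (x q) (t q), t q - h q))) => //.
  exact: (cvg_pair (cfoot _ _ ch) (cvgB ct ch)).
rewrite /bdf2_upper_convected; apply: cvgZ.
  by apply: cvgV => //; rewrite mulf_neq0.
apply: cvgD; last exact: ctr.
apply: cvgB; last by apply: cvgZ; [exact: cvg_cst|exact: ctr].
by apply: cvgZ; [exact: cvg_cst|exact: cvg_tensor cp0 cp].
Qed.

End scheme_limit.

Lemma frobenius_le m n (A : 'M[R]_(m, n)) K : 0 <= K ->
  (forall i j, `|A i j| <= K) -> frobenius A <= (m * n)%:R * K.
Proof.
move=> K0 AK; case: m A AK => [|m] A AK.
  by rewrite /frobenius big_ord0 sqrtr0 mul0r.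
case: n A AK => [|n] A AK.
  by rewrite /frobenius big1 ?sqrtr0 ?muln0 ?mul0r// => i _; rewrite big_ord0.
rewrite -(@ler_pXn2r _ 2)// ?nnegrE ?sqrtr_ge0 ?mulr_ge0// frobenius_sqr.
rewrite (@le_trans _ _ (\sum_(i < m.+1) \sum_(j < n.+1) K ^+ 2))//.
  apply: ler_sum => i _; apply: ler_sum => j _.
  by rewrite -real_normK ?num_real// lerXn2r ?nnegrE.
rewrite !sumr_const !card_ord -mulrnA mulnC exprMn -[leLHS]mulr_natl.
rewrite ler_wpM2r ?sqr_ge0//.
by rewrite -natrX ler_nat expnS expn1 leq_pmulr.
Qed.

End limit.

(** * The estimate in the open cylinder and its extension to the closed one *)

Theorem theorem1 (R : realType) (d : nat) (hd : (1 <= d <= 3)%N)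
    (Omega : set 'cV[R]_d) (Omega_open : open Omega)
    (Omega_connected : connected Omega) (Omega_nonempty : Omega !=set0)
    (Omega_bounded : bounded_set Omega) (T : R) (hT : 0 < T) :
  exists m : nat,
    forall (u : 'cV[R]_d * R -> 'cV[R]_d) (z : 'cV[R]_d * R -> 'M[R]_d),
      (forall i, smooth_upto_boundary Omega T m (fun p => u p i 0)) ->
      (forall x t, (closure Omega `\` Omega°) x -> t \in `[0, T] ->
        u (x, t) = 0) ->
      (forall i j, smooth_upto_boundary Omega T m (fun p => z p i j)) ->
      exists2 C : R, 0 < C &
        forall dt : R, 0 < dt ->
          (dt%:E * seminorm_C0W1oo Omega T u <= (1 / 8)%:E)%E ->
          forall (x : 'cV[R]_d) (t : R), closure Omega x ->
            t \in `[2 * dt, T] ->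
            frobenius (upper_convected Omega T u z (x, t)
                       - bdf2_upper_convected Omega T u z dt x t)
              <= C * dt ^+ 2.
Proof.
(* Three derivatives control the cubic Taylor remainder. *)
exists 3%N => u z su u0 sz.
have [K KP] := bdf2_interior_consistency Omega_open hT Omega_bounded su sz.
(* The factor [d * d] turns the entrywise bound into a Frobenius bound; adding 1 makes [C]
   positive. *)
pose C := (d * d)%:R * (6 * `|K|) + 1.
have C0 : 0 <= (d * d)%:R * (6 * `|K|) by rewrite !mulr_ge0.
exists C => [|dt dt0 dtu x t clx]; first by rewrite ltr_wpDl.
rewrite in_itv /= => /andP[dtt tT].
have dtF p : cylinder Omega T p -> dt * frobenius (gradient Omega T u p) <= 1 / 8.
  move=> cp; rewrite -lee_fin (le_trans _ dtu)// EFinM lee_pmul2l ?lte_fin//.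
  exact: (frobenius_gradient_le_seminorm (m := 2) Omega_open hT su cp).
(* The exit argument is used with [h = 2 * dt'], for which [h] times the gradient norm is at most
   1/4; the strict bound on [t'] keeps all times positive. *)
have pathP dt' x' t' s : 0 < dt' <= dt -> Omega x' -> 2 * dt' < t' < T ->
    0 <= s <= 2 * dt' -> cylinder Omega T (foot u s x' t', t' - s).
  move=> /andP[dt'0 dt'dt] Ox' /andP[t'0 t'T] sdt.
  have tT' : t' \in `]0, T[ by rewrite in_itv /=; apply/andP; split; lra.
  split => /=; last first.
    by rewrite in_itv /=; case/andP: sdt => s0 s2; apply/andP; split; lra.
  have u0' y : (closure Omega `\` Omega°) y -> u (y, t') = 0.
    by move=> /u0; apply; exact: subset_itv_oo_cc.
  apply: (segment_in_domain Omega_open hT su u0' _ _ sdt) => // p cp.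
  have F0 : 0 <= frobenius (gradient Omega T u p) by exact: sqrtr_ge0.
  have := dtF p cp; have : dt' * frobenius (gradient Omega T u p) <=
    dt * frobenius (gradient Omega T u p) by exact: ler_wpM2r.
  lra.
(* The right-hand side carries the fixed [dt] rather than [dt'], so it is constant in the later
   limit. *)
have interior dt' x' t' : 0 < dt' <= dt -> Omega x' -> 2 * dt' < t' < T ->
    frobenius (upper_convected Omega T u z (x', t')
      - bdf2_upper_convected Omega T u z dt' x' t') <= C * dt ^+ 2.
  move=> dt'dt Ox' t'T; have /andP[dt'0 ledt] := dt'dt.
  have B0 : 0 <= 6 * `|K| * dt ^+ 2 by rewrite mulr_ge0 ?sqr_ge0 ?mulr_ge0.
  apply: (@le_trans _ _ ((d * d)%:R * (6 * `|K| * dt ^+ 2))); last first.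
    by rewrite mulrA ler_wpM2r ?sqr_ge0// lerDl.
  apply: frobenius_le => // i j.
  apply: (@le_trans _ _ (6 * K * dt' ^+ 2)).
    have dt'T : 2 * dt' <= T by case/andP: t'T => t'0 t'T; lra.
    by apply: KP => // s s2; rewrite -foot_line; exact: pathP t'T s2.
  apply: (@le_trans _ _ (6 * `|K| * dt' ^+ 2)).
    by rewrite ler_wpM2r ?sqr_ge0// ler_wpM2l// ler_norm.
  by rewrite ler_wpM2l ?mulr_ge0// lerXn2r// nnegrE ltW.
(* Approximating [(x, t)] from inside the open cylinder keeps [2 dt' < t'] only
   if the step is shrunk along with the time. *)
pose F := filter_prod (within Omega (nbhs x)) (0 : R)^'+.
have PF : ProperFilter (within Omega (nbhs x)) by exact: within_nbhs_proper.
have FF : ProperFilter F by exact: filter_prod_proper.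
(* With r = [q.2], the step (1 - r) dt and the time t - r dt give a time minus two steps of t - 2 dt
   + r dt > 0, while the time itself is below [T]. *)
pose dtq (q : 'cV[R]_d * R) := (1 - q.2) * dt.
pose tq (q : 'cV[R]_d * R) := t - q.2 * dt.
have q1 : q.1 @[q --> F] --> x.
  by apply: cvg_trans cvg_fst _; exact: cvg_within.
have q2 : q.2 @[q --> F] --> (0 : R).
  by apply: cvg_trans cvg_snd _; exact: cvg_within.
have cdt : dtq q @[q --> F] --> dt.
  have : dtq q @[q --> F] --> (1 - 0) * dt.
    by apply: cvgM; [apply: cvgB; [exact: cvg_cst|exact: q2]|exact: cvg_cst].
  by rewrite subr0 mul1r.
have ct : tq q @[q --> F] --> t.
  have : tq q @[q --> F] --> t - 0 * dt.
    by apply: cvgB; [exact: cvg_cst|apply: cvgM; [exact: q2|exact: cvg_cst]].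
  by rewrite mul0r subr0.
have nearF : \forall q \near F,
    [/\ 0 < dtq q <= dt, Omega q.1 & 2 * dtq q < tq q < T].
  have near01 : \forall q \near F, Omega q.1 /\ 0 < q.2 < 1.
    exists (Omega, [set r | 0 < r < 1]) => [|[y r] [] //]; split => /=.
      exact: withinT.
    near=> r; apply/andP; split; near: r; first exact: nbhs_right_gt.
    exact: nbhs_right_lt.
  apply: filterS near01 => q [Oq /andP[q0 qlt1]].
  have qdt0 : 0 < q.2 * dt by exact: mulr_gt0.
  have qdt1 : q.2 * dt < dt by rewrite gtr_pMl.
  by split=> //; rewrite /dtq /tq; apply/andP; split; lra.
(* The values 0, 1, 2 of [c] give the point itself and the two feet. *)
have footq (c : R) : 0 <= c <= 2 -> \forall q \near F,
    cylinder Omega T (foot u (c * dtq q) q.1 (tq q), tq q - c * dtq q).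
  move=> /andP[c0 c2]; apply: filterS nearF => q [dtq0 Oq tqT].
  apply: pathP tqT _ => //; case/andP: dtq0 => dtq0 _.
  by rewrite mulr_ge0 ?ler_wpM2r// ltW.
have cp : \forall q \near F, ccylinder Omega T (q.1, tq q).
  have := footq 0; rewrite lexx ler0n => /(_ isT); apply: filterS => q.
  by rewrite /foot mul0r scale0r !subr0 => /cylinderW.
have cqt : (q.1, tq q) @[q --> F] --> (x, t) by exact: (cvg_pair q1 ct).
have cupper : upper_convected Omega T u z (q.1, tq q) @[q --> F] -->
    upper_convected Omega T u z (x, t).
  exact: (cvg_upper_convected hT su sz cqt cp).
have cbdf2 : bdf2_upper_convected Omega T u z (dtq q) q.1 (tq q) @[q --> F] -->
    bdf2_upper_convected Omega T u z dt x t.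
  apply: (cvg_bdf2_upper_convected hT su sz) => //.
  - by rewrite gt_eqF.
  - have := footq 1; rewrite ler01 ler1n => /(_ isT); apply: filterS => q.
    by rewrite !mul1r => /cylinderW.
  - have := footq 2; rewrite ler0n lexx => /(_ isT); apply: filterS => q.
    exact: cylinderW.
have cerr : frobenius (upper_convected Omega T u z (q.1, tq q)
      - bdf2_upper_convected Omega T u z (dtq q) q.1 (tq q)) @[q --> F] -->
    frobenius (upper_convected Omega T u z (x, t)
      - bdf2_upper_convected Omega T u z dt x t).
  by apply: cvg_frobenius => i j; exact: (cvg_entry (cvgB cupper cbdf2)).
apply: (cvgr_to_le cerr).
by apply: filterS nearF => q []; exact: interior.
Unshelve. all: by end_near. Qed.
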